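(* Let $\mathbb{F}$ be an algebraically closed field and let $n,t\in\mathbb{Z}^+$ with $n=2t+1$. Let $\mathcal{S}$ be a generating system of the full matrix algebra $\mathrm{M}_n(\mathbb{F})$. If $m(\mathcal{S})=t+k$ for some $k\in\{1,2,\ldots,t+1\}$, then $\ell(\mathcal{S})\le 3n-5$.
   Context: $\mathrm{M}_n(\mathbb{F})$ is the algebra of $n\times n$ matrices over $\mathbb{F}$. Let $\mathcal{S}$ be a finite subset of $\mathrm{M}_n(\mathbb{F})$. A word of length $j$ in $\mathcal{S}$ is a product of $j$ elements of $\mathcal{S}$ (repetitions allowed); the identity matrix is regarded as the (empty) word of length $0$. For $i\ge 0$, $L_i(\mathcal{S})$ denotes the $\mathbb{F}$-linear span of all words in $\mathcal{S}$ of length at most $i$, so $L_0(\mathcal{S})$ is the set of scalar matrices. $L(\mathcal{S})=\bigcup_{i\ge 0}L_i(\mathcal{S})$. $\mathcal{S}$ is a generating system of $\mathrm{M}_n(\mathbb{F})$ if $L(\mathcal{S})=\mathrm{M}_n(\mathbb{F})$. The length $\ell(\mathcal{S})$ of a generating system $\mathcal{S}$ is the minimum non-negative integer $i$ such that $L_i(\mathcal{S})=\mathrm{M}_n(\mathbb{F})$. For a matrix $w$, $\deg w$ denotes the degree of the minimal polynomial of $w$ over $\mathbb{F}$, and $m(\mathcal{S})=\max\{\deg w : w\in\mathcal{S}\}$. *)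

(* Defs.v *)
From HB Require Import structures.
From mathcomp Require Import all_boot all_order all_algebra.
From mathcomp Require Import finmap.

Set Implicit Arguments.
Unset Strict Implicit.
Unset Printing Implicit Defensive.

Import GRing.Theory.
Local Open Scope ring_scope.

(* The size is n'.+1 because mathcomp provides the nontrivial ring structure  *)
(* and mxminpoly only for matrices of manifestly nonzero size.                *)
Section Length.

Variables (F : fieldType) (n' : nat).
Local Notation n := n'.+1.
Implicit Types (S : {fset 'M[F]_n}) (A : 'M[F]_n) (i j : nat).

Definition words S j : seq 'M[F]_n :=
  [seq \prod_(x <- w) val x | w : j.-tuple S].

Definition Lspan S i : {vspace 'M[F]_n} :=
  <<flatten [seq words S j | j <- iota 0 i.+1]>>%VS.

Definition generating S : Prop := forall A, exists i, A \in Lspan S i.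

Lemma Lspan_mono S i j : (i <= j)%N -> (Lspan S i <= Lspan S j)%VS.
Proof.
move=> le_ij; apply: sub_span => A /flattenP[_ /mapP[l l_i ->] Al].
apply/flattenP; exists (words S l) => //; apply: map_f.
by move: l_i; rewrite !mem_iota !add0n !ltnS => /leq_trans->.
Qed.

Lemma generating_Lspan S : generating S -> exists i, Lspan S i == fullv.
Proof.
move=> genS.
have sub_seq (s : seq 'M[F]_n) : exists i, {subset s <= Lspan S i}.
  elim: s => [|A s [i sub_s]]; first by exists 0%N.
  have [j Aj] := genS A; exists (maxn i j) => B.
  rewrite inE => /predU1P[->|/sub_s Bi].
    exact: (subvP (Lspan_mono S (leq_maxr i j))).
  exact: (subvP (Lspan_mono S (leq_maxl i j))).
have [i sub_i] := sub_seq (vbasis fullv).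
exists i; rewrite eqEsubv subvf -(span_basis (vbasisP fullv)).
exact/span_subvP.
Qed.

Definition gen_length S (genS : generating S) : nat :=
  ex_minn (generating_Lspan genS).

Definition mxdeg A : nat := (size (mxminpoly A)).-1.

Definition max_mxdeg S : nat := \max_(A <- S) mxdeg A.

End Length.

(* Main.v *)
(* Let A in S have minimal polynomial p of degree m > n/2, write L_i for     *)
(* Lspan S i, and for a root a of p let p_a = p / (X - a). Removing the       *)
(* linear factors of p one at a time raises the rank by at least the minimum  *)
(* of the \rank (p_a(A)), which is at least 1 by minimality of p. Hence, as   *)
(* n < 2m, some p_a(A) is a rank one matrix c r, lying in L_(m-1).            *)
(* Since S generates, L_i c and r L_i have dimension at least min(i+1, n);    *)
(* so x r Y is in L_(m-1 + n-1 + n-2) for every column x and Y in L_(n-2),    *)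
(* and the rows r Y fill a hyperplane H. Every M agrees with some W in        *)
(* L_(n-1) on a column whose left kernel is H, so the rows of M - W are in H; *)
(* this shows L_(m+2n-4) is everything, which suffices for m < n.             *)
(* If m = n then every A - a has corank 1 when a is an eigenvalue, and the    *)
(* same correction M = W + D (A - a) with W in L_(n-1) lets one prove         *)
(* M q(A) in L_(2n-2) for all M and all divisors q of p, starting from q = p  *)
(* and ending at q = 1.                                                       *)

Require Import Defs.
From HB Require Import structures.
From mathcomp Require Import all_boot all_order all_algebra.
From mathcomp Require Import finmap.
From mathcomp Require Import falgebra.
From mathcomp Require Import zify.

Set Implicit Arguments.
Unset Strict Implicit.
Unset Printing Implicit Defensive.

Import GRing.Theory.
Local Open Scope ring_scope.

(** * Spans of products and chains of subspaces *)

Lemma span_prodv_le (K : fieldType) (aT : FalgType K) (X Y : seq aT)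
    (V : {vspace aT}) :
  {in X & Y, forall x y, x * y \in V} -> (<<X>> * <<Y>> <= V)%VS.
Proof.
move=> XYV; apply/prodvP => u v.
rewrite -[X]in_tupleE -[Y]in_tupleE => /coord_span-> /coord_span->.
rewrite mulr_suml memv_suml // => i _; rewrite mulr_sumr memv_suml // => j _.
by rewrite -scalerAl -scalerAr !memvZ // XYV // mem_nth.
Qed.

(** A chain that stalls once stays constant, hence already equals the full space it eventually
    reaches; until then each step gains at least one dimension. *)
Lemma dim_chain_ge (K : fieldType) (vT : vectType K) (V : nat -> {vspace vT}) :
    (forall i, (V i <= V i.+1)%VS) ->
    (forall i, (V i.+1 <= V i)%VS -> (V i.+2 <= V i.+1)%VS) ->
    (0 < \dim (V 0))%N -> (exists i, V i = fullv) ->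
  forall d, (minn d.+1 (\dim {:vT}) <= \dim (V d))%N.
Proof.
move=> Vmono Vstab V0 [e Ve].
have stable d : (V d.+1 <= V d)%VS -> V d = fullv.
  (* The second conjunct, the stall at step [d + k], is carried along because [Vstab] needs it to
     pass to the next step. *)
  move=> Vd; suff Vk k : (V (d + k)%N.+1 <= V d)%VS /\ (V (d + k)%N.+1 <= V (d + k)%N)%VS.
    apply/eqP; rewrite eqEsubv subvf -Ve /=.
    have Vle i j : (V i <= V (i + j)%N)%VS.
      by elim: j => [|j IHj]; rewrite ?addn0 ?addnS // (subv_trans IHj).
    apply: subv_trans (Vle e d.+1) _.
    by rewrite addnS addnC; case: (Vk e).
  elim: k => [|k [IH1 IH2]]; first by rewrite addn0.
  have IH3 := Vstab _ IH2; rewrite addnS; split=> //.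
  exact: subv_trans IH3 IH1.
elim=> [|d IHd]; first by rewrite geq_min V0.
have [/stable Vd|nVd] := boolP (V d.+1 <= V d)%VS.
  by rewrite geq_min; apply/orP; right; rewrite -Vd dimvS.
have: (\dim (V d) < \dim (V d.+1))%N.
  rewrite ltn_neqAle dimvS // andbT; apply: contra nVd => /eqP eq_d.
  have /eqP-> : V d == V d.+1 by rewrite eqEdim Vmono eq_d leqnn.
  exact: subvv.
by move: IHd; rewrite !geq_min => /orP[] *; apply/orP; lia.
Qed.

(** * Matrices of rank or corank at most one *)

Section Rank.

Variable F : fieldType.

Lemma rank_le1 m n (A : 'M[F]_(m, n)) :
  (\rank A <= 1)%N -> exists c : 'cV_m, exists r : 'rV_n, A = c *m r.
Proof.
move=> rkA; have [->|/rowV0Pn[r rA r0]] := eqVneq A 0.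
  by exists 0, 0; rewrite mul0mx.
suff /submxP[c ->] : (A <= r)%MS by exists c, r.
by rewrite -(geq_leqif (mxrank_leqif_sup rA)) rank_rV r0.
Qed.

(** Corank at most one makes the cokernel matrix a product [c *m r], so the single column [c] tests
    membership in the row space of [B]. *)
Lemma cokermx_col m n (B : 'M[F]_(m, n.+1)) : (n <= \rank B)%N ->
  exists c : 'cV_n.+1, forall p (u : 'M_(p, n.+1)),
    u *m c = 0 -> (u <= B)%MS.
Proof.
move=> rkB; have [|c [r def_cr]] := @rank_le1 _ _ (cokermx B).
  by rewrite mxrank_coker; lia.
by exists c => p u uc0; rewrite submxE def_cr mulmxA uc0 mul0mx.
Qed.

Lemma vspace_rows n (T : {vspace 'rV[F]_n}) :
  exists2 B : 'M_(\dim T, n), \rank B = \dim T &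
    forall u : 'rV_n, (u <= B)%MS -> u \in T.
Proof.
pose B : 'M_(\dim T, n) := \matrix_i (vbasis T)`_i; exists B.
  apply/eqP/inj_row_free => u uB0; apply/rowP => i; rewrite mxE.
  have /freeP freeT := basis_free (vbasisP T).
  apply: (freeT (fun i => u 0 i)); rewrite -[RHS]uB0 mulmx_sum_row.
  by apply: eq_bigr => j _; rewrite rowK.
move=> u /submxP[D ->]; rewrite mulmx_sum_row memv_suml // => i _.
by rewrite rowK memvZ // vbasis_mem // mem_nth ?size_tuple.
Qed.

End Rank.

(** * Products of linear factors in a matrix *)

Section Factors.

Variables (F : fieldType) (n' : nat).
Local Notation n := n'.+1.
Implicit Types (A : 'M[F]_n) (a : F) (s rs : seq F).

(** When [rs] lists the roots of the minimal polynomial p with multiplicity,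
    [linear_factors A (rem a rs)] is p_a(A). *)
Definition linear_factors A s : 'M[F]_n :=
  horner_mx A (\prod_(a <- s) ('X - a%:P)).

Lemma linear_factors_nil A : linear_factors A [::] = 1.
Proof. by rewrite /linear_factors big_nil rmorph1. Qed.

Lemma linear_factors_cons A a s :
  linear_factors A (a :: s) = (A - a%:M) * linear_factors A s.
Proof.
rewrite /linear_factors big_cons rmorphM rmorphB /=.
by rewrite horner_mx_X horner_mx_C.
Qed.

Lemma linear_factors_cat A s1 s2 :
  linear_factors A (s1 ++ s2) = linear_factors A s1 * linear_factors A s2.
Proof. by rewrite /linear_factors big_cat rmorphM. Qed.

Lemma perm_linear_factors A s1 s2 :
  perm_eq s1 s2 -> linear_factors A s1 = linear_factors A s2.
Proof. by move=> eq_s; rewrite /linear_factors (perm_big _ eq_s). Qed.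

Lemma linear_factorsC A s1 s2 :
  linear_factors A s1 * linear_factors A s2
    = linear_factors A s2 * linear_factors A s1.
Proof. by rewrite -!rmorphM mulrC. Qed.

Lemma linear_factorsCr A a s :
  linear_factors A (a :: s) = linear_factors A s * (A - a%:M).
Proof.
rewrite -[a :: s]cat1s linear_factors_cat linear_factorsC.
by rewrite linear_factors_cons linear_factors_nil mulr1.
Qed.

Lemma linear_factors_neq0 A s :
  (size s < mxdeg A)%N -> linear_factors A s != 0.
Proof.
move=> lt_s; apply/eqP => /mxminpoly_min /dvdp_leq.
rewrite -size_poly_eq0 size_prod_XsubC => /(_ isT).
move: lt_s; rewrite /mxdeg -ltnS; case: (size (mxminpoly A)) => [|k] /=; lia.
Qed.

(* The kernel of A - a meets the row space of the product over s1 in at least *)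
(* the row space of the product over rem a rs, so appending a to s1 lowers    *)
(* the rank by at least c.                                                    *)
Lemma rank_linear_factors A rs c :
    linear_factors A rs = 0 ->
    (forall a, a \in rs -> c <= \rank (linear_factors A (rem a rs)))%N ->
  forall s1 s2, perm_eq (s1 ++ s2) rs ->
    (c * size s2 <= \rank (linear_factors A s1))%N.
Proof.
move=> rs0 rkc s1 s2; elim: s2 s1 => [|a s2 IHs2] s1 eq_rs; first by rewrite muln0.
have s1a : perm_eq (a :: s1 ++ s2) rs.
  by apply: perm_trans eq_rs; rewrite perm_sym -[a :: s2]cat1s perm_catCA.
have a_rs : a \in rs by rewrite -(perm_mem s1a) mem_head.
have rem_a : perm_eq (s1 ++ s2) (rem a rs).
  by rewrite -(perm_cons a) (perm_trans s1a) // perm_to_rem.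
rewrite mulnS addnC -(mxrank_mul_ker _ (A - a%:M)) leq_add //.
  by rewrite -[_ *m _]linear_factorsCr IHs2.
apply: leq_trans (rkc a a_rs) _; apply: mxrankS.
rewrite -(perm_linear_factors _ rem_a) sub_capmx; apply/andP; split.
  by rewrite linear_factors_cat linear_factorsC submxMl.
apply/sub_kermxP; rewrite -[LHS]linear_factorsCr -[RHS]rs0.
exact: perm_linear_factors.
Qed.

End Factors.

(** * The filtration by word length and its action on columns and rows *)

Section Lengths.

Variables (F : fieldType) (n' : nat) (S : {fset 'M[F]_n'.+1}).
Local Notation n := n'.+1.
Implicit Types (A M : 'M[F]_n) (i j : nat).

(** As powers of one subspace, the spans multiply by adding exponents, and a single letter can be
    split off on either side. *)
Lemma Lspan_expv i : Lspan S i = ((1 + <<S>>) ^+ i)%VS.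
Proof.
set U := (1 + <<S>>)%VS.
have U1 : (1 <= U)%VS by apply: addvSl.
have US : {subset S <= U}.
  by move=> A AS; apply: (subvP (addvSr _ _)); apply: memv_span.
have Umono j k : (j <= k)%N -> (U ^+ j <= U ^+ k)%VS.
  by move=> /subnK <-; rewrite expvD -[X in (X <= _)%VS]prod1v prodvSl //
    -(expv1n _ (k - j)) expvS.
apply/eqP; rewrite eqEsubv; apply/andP; split.
  apply/span_subvP => _ /flattenP[_ /mapP[j j_i ->] /mapP[w _ ->]].
  apply: (subvP (@Umono j i _)).
    by move: j_i; rewrite mem_iota add0n ltnS.
  rewrite -[X in (_ ^+ X)%VS](size_tuple w).
  elim: (tval w) => [|x s IHs]; first by rewrite big_nil expv0 memv_line.
  by rewrite big_cons expvSl memv_mul // US // fsvalP.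
elim: i => [|i IHi].
  rewrite expv0 -memvE; apply: memv_span; apply/flattenP.
  exists (words S 0); first by rewrite map_f.
  by apply/mapP; exists [tuple]; rewrite ?mem_enum ?big_nil.
rewrite expvSl (subv_trans (prodvSr _ IHi)) // prodvDl prod1v subv_add.
rewrite Lspan_mono //=; apply: span_prodv_le => x _ xS /flattenP[_ /mapP[j j_i ->] /mapP[w _ ->]].
apply: memv_span; apply/flattenP; exists (words S j.+1).
  by rewrite map_f //; move: j_i; rewrite !mem_iota; lia.
apply/mapP; exists [tuple of FSetSub xS :: w]; rewrite ?mem_enum //=.
by rewrite big_cons.
Qed.

Lemma Lspan_mul i j A M :
  A \in Lspan S i -> M \in Lspan S j -> A * M \in Lspan S (i + j).
Proof. by rewrite !Lspan_expv expvD; apply: memv_mul. Qed.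

Lemma mem_Lspan1 A : A \in S -> A \in Lspan S 1.
Proof.
by move=> AS; rewrite Lspan_expv expv1 (subvP (addvSr _ _)) // memv_span.
Qed.

Lemma scalar_Lspan a i : a%:M \in Lspan S i.
Proof.
apply: (subvP (Lspan_mono S (leq0n i))).
by rewrite Lspan_expv expv0 -scalemx1 memvZ // memv_line.
Qed.

Lemma linear_factors_Lspan A s :
  A \in S -> linear_factors A s \in Lspan S (size s).
Proof.
move=> AS; elim: s => [|a s IHs].
  by rewrite linear_factors_nil; apply: scalar_Lspan.
rewrite linear_factors_cons -[size _]add1n Lspan_mul // rpredB ?scalar_Lspan //.
exact: mem_Lspan1.
Qed.

Lemma gen_length_le (genS : generating S) N :
  (forall M, M \in Lspan S N) -> (gen_length genS <= N)%N.
Proof.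
move=> LN; rewrite /gen_length; case: ex_minnP => k _; apply.
by rewrite eqEsubv subvf; apply/subvP=> M _.
Qed.

Hypothesis genS : generating S.

Lemma Lspan_full : exists e, Lspan S e = fullv.
Proof. by have [e /eqP] := generating_Lspan genS; exists e. Qed.

(** The spaces L_i c form a chain as in [dim_chain_ge], starting in dimension 1, so L_(n-1) c
    contains every column. *)
Lemma Lspan_cols (c : 'cV[F]_n) M : exists2 W, W \in Lspan S n' & W *m c = M *m c.
Proof.
have [->|c0] := eqVneq c 0; first by exists 0; rewrite ?mem0v ?mulmx0.
pose f := linfun (@mulmxr F n n 1 c); pose V d := (f @: Lspan S d)%VS.
have [e Le] := Lspan_full.
have Ve : V e = fullv.
  apply/eqP; rewrite eqEsubv subvf; apply/subvP => y _.
  have [k ck] : exists k, c k 0 != 0 by case/cV0Pn: c0 => k; exists k.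
  (* This matrix has [y] divided by [c k 0] as column [k] and zeros elsewhere, so it sends [c] to
     [y]. *)
  apply/memv_imgP; exists ((c k 0)^-1 *: (y *m delta_mx 0 k)).
    by rewrite Le memvf.
  rewrite lfunE /= -scalemxAl -mulmxA -rowE [row k c]mx11_scalar mxE.
  by rewrite mul_mx_scalar scalerA mulVf ?scale1r.
have Vmono i : (V i <= V i.+1)%VS by rewrite limgS // Lspan_mono.
have Vstab i : (V i.+1 <= V i)%VS -> (V i.+2 <= V i.+1)%VS.
  move=> Vi; apply/subvP => _ /memv_imgP[M' M'L ->]; rewrite memv_preim.
  apply: subvP M'L; rewrite [in X in (X <= _)%VS]Lspan_expv expvSl -!Lspan_expv.
  (* Since L_(i+1) c lies in L_i c, the column B c equals C c with C in L_i; then A C in L_(i+1)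
     replaces A B. *)
  apply/prodvP => A B AL BL; rewrite -memv_preim lfunE /= -mulmxA.
  have /memv_imgP[C CL] : B *m c \in V i.
    by apply: (subvP Vi); apply/memv_imgP; exists B; rewrite ?lfunE.
  rewrite lfunE /= => ->; rewrite mulmxA.
  by apply/memv_imgP; exists (A * C); rewrite ?lfunE // -[i.+1]add1n
    Lspan_mul // Lspan_expv expv1.
have V0 : (0 < \dim (V 0%N))%N.
  rewrite lt0n dimv_eq0; apply: contraNneq c0 => V0.
  rewrite -memv0 -V0; apply/memv_imgP; exists 1; rewrite ?scalar_Lspan //.
  by rewrite lfunE /= mul1mx.
have := dim_chain_ge Vmono Vstab V0 (ex_intro _ e Ve) n'.
rewrite dimvf /dim /= muln1 minnn => dimV.
have /memv_imgP[W WL eqW] : M *m c \in V n'.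
  suff /eqP-> : V n' == fullv by rewrite memvf.
  by rewrite eqEdim subvf dimvf /dim /= muln1.
by exists W; rewrite // eqW lfunE.
Qed.

(** Mirror image of [Lspan_cols], splitting letters off on the right; [d] stays free because
    stopping at n-2 already yields a hyperplane of rows. *)
Lemma Lspan_rows_dim (r : 'rV[F]_n) d : r != 0 ->
  (minn d.+1 n <= \dim (linfun (@mulmx F 1 n n r) @: Lspan S d))%N.
Proof.
move=> r0; set f := linfun _; pose V d := (f @: Lspan S d)%VS.
have [e Le] := Lspan_full.
have Ve : V e = fullv.
  apply/eqP; rewrite eqEsubv subvf; apply/subvP => y _.
  have [k rk] : exists k, r 0 k != 0 by case/rV0Pn: r0 => k; exists k.
  apply/memv_imgP; exists ((r 0 k)^-1 *: (delta_mx k 0 *m y)).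
    by rewrite Le memvf.
  rewrite lfunE /= -scalemxAr mulmxA -colE [col k r]mx11_scalar mxE.
  by rewrite mul_scalar_mx scalerA mulVf ?scale1r.
have Vmono i : (V i <= V i.+1)%VS by rewrite limgS // Lspan_mono.
have Vstab i : (V i.+1 <= V i)%VS -> (V i.+2 <= V i.+1)%VS.
  move=> Vi; apply/subvP => _ /memv_imgP[M' M'L ->]; rewrite memv_preim.
  apply: subvP M'L; rewrite [in X in (X <= _)%VS]Lspan_expv expvSr -!Lspan_expv.
  apply/prodvP => A B AL BL; rewrite -memv_preim lfunE /= mulmxA.
  have /memv_imgP[C CL] : r *m A \in V i.
    by apply: (subvP Vi); apply/memv_imgP; exists A; rewrite ?lfunE.
  rewrite lfunE /= => ->; rewrite -mulmxA.
  by apply/memv_imgP; exists (C * B); rewrite ?lfunE // -[i.+1]addn1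
    Lspan_mul // Lspan_expv expv1.
have V0 : (0 < \dim (V 0%N))%N.
  rewrite lt0n dimv_eq0; apply: contraNneq r0 => V0.
  rewrite -memv0 -V0; apply/memv_imgP; exists 1; rewrite ?scalar_Lspan //.
  by rewrite lfunE /= mulmx1.
have := dim_chain_ge Vmono Vstab V0 (ex_intro _ e Ve) d.
by rewrite dimvf /dim /= mul1n.
Qed.

Lemma Lspan_modulo_rows m (B : 'M[F]_(m, n)) M : (n' <= \rank B)%N ->
  exists2 W, W \in Lspan S n' & (M - W <= B)%MS.
Proof.
case/cokermx_col=> c cB; have [W WL eqW] := Lspan_cols c M.
by exists W => //; apply: cB; rewrite mulmxBl eqW subrr.
Qed.

Lemma Lspan_rank1 h A : (0 < n')%N -> A \in Lspan S h -> \rank A = 1%N ->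
  forall M, M \in Lspan S (h + n' + n'.-1).
Proof.
move=> n'_gt0 AL rkA M.
have [|c [r defA]] := @rank_le1 _ _ _ A; first by rewrite rkA.
have r0 : r != 0.
  by apply: contra_eq_neq rkA => r0; rewrite defA r0 mulmx0 mxrank0.
(* As [N * A] is (N c) r, it depends only on the column N c, which some W in L_(n-1) reproduces. *)
have mulA N : N * A \in Lspan S (h + n').
  have [W WL eqW] := Lspan_cols c N.
  suff -> : N * A = W * A by rewrite addnC Lspan_mul.
  by rewrite defA -[LHS]/(N *m _) -[RHS]/(W *m _) !mulmxA eqW.
have [B rkB BT] := vspace_rows (linfun (@mulmx F 1 n n r) @: Lspan S n'.-1).
have [|W WL /row_subP WB] := @Lspan_modulo_rows _ B M.
  by rewrite rkB; apply: leq_trans (Lspan_rows_dim _ r0); lia.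
rewrite -[M](subrK W) rpredD //; last first.
  by apply: (subvP (Lspan_mono S _)) WL; rewrite -addnA addnCA leq_addr.
(* Each row of M - W has the form r Y, and e_i r is a multiple of E_ik A when [c k 0] is nonzero, so
   [mulA] bounds its length before Y is appended. *)
rewrite -[M - W]mul1mx mx1_sum_delta mulmx_suml memv_suml // => i _.
rewrite -(mul_delta_mx (0 : 'I_1)) -mulmxA -rowE.
have /memv_imgP[Y YL ->] := BT _ (WB i).
have [k ck] : exists k, c k 0 != 0.
  apply/cV0Pn/eqP => c0.
  by move: rkA; rewrite defA c0 mul0mx mxrank0.
rewrite lfunE /= mulmxA.
suff -> : delta_mx i 0 *m r = (c k 0)^-1 *: delta_mx i k * A by rewrite Lspan_mul.
rewrite defA -[RHS]/(_ *m _) mulmxA -scalemxAl -(mul_delta_mx (0 : 'I_1) i k).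
rewrite -[_ *m delta_mx 0 k *m c]mulmxA -rowE [row k c]mx11_scalar mxE mul_mx_scalar.
by rewrite scalerA mulVf ?scale1r.
Qed.

Lemma Lspan_nonderogatory A rs : A \in S -> linear_factors A rs = 0 ->
  size rs = n -> (n <= mxdeg A)%N -> forall M, M \in Lspan S (n' + n').
Proof.
move=> AS rs0 szrs degA M.
have rk1 a : a \in rs -> (1 <= \rank (linear_factors A (rem a rs)))%N.
  move=> a_rs; rewrite lt0n mxrank_eq0 linear_factors_neq0 //.
  by rewrite size_rem // szrs.
(* The induction on [s2] moves one factor at a time from [s1] back to [s2], from the zero product
   over [rs] to the empty product. *)
suff: forall s1 s2, perm_eq (s1 ++ s2) rs ->
    forall M, M * linear_factors A s1 \in Lspan S (n' + n').
  by move=> /(_ [::] rs (perm_refl _) M); rewrite linear_factors_nil mulr1.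
move=> s1 s2; elim: s2 s1 {M} => [|a s2 IHs2] s1 eq_rs M.
  rewrite cats0 in eq_rs.
  by rewrite (perm_linear_factors _ eq_rs) rs0 mulr0 mem0v.
have s1a : perm_eq ((a :: s1) ++ s2) rs.
  by apply: perm_trans eq_rs; rewrite perm_sym -[a :: s2]cat1s perm_catCA.
have rkA : (n' <= \rank (A - a%:M)%R)%N.
  have a_rs : a \in rs by rewrite -(perm_mem s1a) mem_head.
  (* Removing the other n-1 factors from A - a leads to the identity and gains rank at least 1 each
     time, so A - a has rank at least n-1. *)
  have := rank_linear_factors rs0 rk1 (s1 := [:: a]) (s2 := rem a rs).
  rewrite perm_sym perm_to_rem // => /(_ isT).
  by rewrite mul1n size_rem // szrs linear_factors_cons linear_factors_nil mulr1.
have [W WL /submxP[D defD]] := Lspan_modulo_rows M rkA.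
rewrite -[M](subrK W) mulrDl rpredD //.
  (* The part D (A - a) supplies one more factor and falls under the induction hypothesis; the part
     W meets at most n-1 factors. *)
  by rewrite defD -[_ *m _]/(D * _) -mulrA -linear_factors_cons IHs2.
have sz1 : (size s1 <= n')%N.
  by have := perm_size s1a; rewrite szrs /= size_cat; lia.
apply: (subvP (Lspan_mono S _)) (Lspan_mul WL (linear_factors_Lspan _ AS)).
by rewrite leq_add2l.
Qed.

End Lengths.

(** * Minimal polynomials of large degree and the final bound *)

(** If every p_a(A) had rank at least 2, removing all the factors of p(A) = 0 would give the
    identity rank at least 2 deg p, exceeding n. *)
Lemma rank1_of_large_degree (F : fieldType) n' (A : 'M[F]_n'.+1) rs :
    linear_factors A rs = 0 -> size rs = mxdeg A -> (n'.+1 < 2 * mxdeg A)%N ->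
  exists2 a, a \in rs & \rank (linear_factors A (rem a rs)) = 1%N.
Proof.
move=> rs0 szrs degA.
have [/hasP[a a_rs rk_a]|/hasPn rk2] :=
    boolP (has (fun a => \rank (linear_factors A (rem a rs)) <= 1)%N rs).
  exists a => //; apply/eqP; rewrite eqn_leq rk_a lt0n mxrank_eq0.
  rewrite linear_factors_neq0 // size_rem // szrs prednK //.
  by rewrite -szrs; case: (rs) a_rs.
have rk_ge2 a : a \in rs -> (2 <= \rank (linear_factors A (rem a rs)))%N.
  by move/rk2; rewrite -ltnNge.
have := rank_linear_factors rs0 rk_ge2 (s1 := [::]) (perm_refl rs).
by rewrite linear_factors_nil mxrank1 szrs; lia.
Qed.

Lemma mxminpoly_linear_factors (F : closedFieldType) n' (A : 'M[F]_n'.+1) :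
  exists2 rs, linear_factors A rs = 0 & size rs = mxdeg A.
Proof.
have [rs def_rs] := closed_field_poly_normal (mxminpoly A).
rewrite (monicP (mxminpoly_monic A)) scale1r in def_rs.
exists rs; first by rewrite /linear_factors -def_rs mx_root_minpoly.
by rewrite /mxdeg def_rs size_prod_XsubC.
Qed.

Lemma mxdeg_le (F : fieldType) n' (A : 'M[F]_n'.+1) : (mxdeg A <= n'.+1)%N.
Proof.
have /dvdp_leq := mxminpoly_dvd_char A.
rewrite -size_poly_eq0 size_char_poly => /(_ isT).
by rewrite /mxdeg; case: size.
Qed.

Lemma ex_max_mxdeg (F : fieldType) n' (S : {fset 'M[F]_n'.+1}) :
  (0 < max_mxdeg S)%N -> exists2 A, A \in S & mxdeg A = max_mxdeg S.
Proof.
move=> m_gt0; have [/hasP[A AS /eqP degA]|/hasPn ltS] :=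
    boolP (has (fun A => mxdeg A == max_mxdeg S) S).
  by exists A.
suff: (max_mxdeg S <= (max_mxdeg S).-1)%N by lia.
apply/bigmax_leqP_seq => A AS _; rewrite -ltnS prednK //.
by rewrite ltn_neqAle ltS // leq_bigmax_seq.
Qed.

Local Close Scope ring_scope.

Theorem theorem1p3 (F : closedFieldType) (n' t : nat) (t_gt0 : 0 < t)
    (n_eq : n'.+1 = 2 * t + 1) (S : {fset 'M[F]_n'.+1})
    (genS : generating S) (k : nat) (k_ge1 : 1 <= k) (k_le : k <= t + 1)
    (mS : max_mxdeg S = t + k) :
  gen_length genS <= 3 * n'.+1 - 5.
Proof.
have [|A AS degA] := @ex_max_mxdeg _ _ S; first by rewrite mS; lia.
rewrite mS in degA.
have [rs rs0 szrs] := mxminpoly_linear_factors A.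
apply: gen_length_le => M.
have [deg_lt|deg_ge] := ltnP (mxdeg A) n'.+1.
  (* Here n = 2t + 1 is less than 2 (t + k) because k is at least 1. *)
  have [|a a_rs rk1] := rank1_of_large_degree rs0 szrs; first by lia.
  have := Lspan_rank1 genS _ (linear_factors_Lspan _ AS) rk1.
  rewrite size_rem // szrs => /(_ _ M) RL.
  (* With m at most n-1, the length (m-1) + (n-1) + (n-2) is at most 3n-5. *)
  by apply: (subvP (Lspan_mono S _)) (RL _); lia.
have degA_n : size rs = n'.+1 by apply/eqP; rewrite szrs eqn_leq mxdeg_le.
have := Lspan_nonderogatory genS AS rs0 degA_n deg_ge M.
(* The bound 2n-2 is at most 3n-5 since n is at least 3. *)
by apply: (subvP (Lspan_mono S _)); lia.
Qed.
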